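(* Let $p$ be a complex polynomial with exactly two distinct roots, and let $h\in\mathbb{C}$ satisfy $|h-\mu|<\mu$, where $\mu$ is the smaller of the two root multiplicities. Then the Julia set of the relaxed Newton map $N_{h,p}(z)=z-h\,p(z)/p'(z)$ is a (straight) line (together with $\infty$) if and only if the two roots of $p$ have equal multiplicity and $h$ is real.
   Context: $N_{h,p}$ is regarded as a rational map of the Riemann sphere; its Julia set is the complement of the set of points where the iterates form a normal family. The condition $|h-\mu|<\mu$ ensures both roots are attracting fixed points of $N_{h,p}$ (a root of multiplicity $\mu_0$ has multiplier $1-h/\mu_0$). *)

(* Defs.v *)
From mathcomp Require Import all_boot all_order all_algebra.
From mathcomp Require Import reals.
From mathcomp.real_closed Require Import complex.

Set Implicit Arguments.
Unset Strict Implicit.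
Unset Printing Implicit Defensive.

Import Order.TTheory GRing.Theory Num.Theory.
Local Open Scope ring_scope.

(* The Riemann sphere C ∪ {∞}: [Some z] is the finite point z, [None] is ∞. *)
Definition sphere (R : realType) := option R[i].

Definition cabs (R : realType) (z : R[i]) : R :=
  Num.sqrt (complex.Re z ^+ 2 + complex.Im z ^+ 2).

Definition chordal (R : realType) (x y : sphere R) : R :=
  match x, y with
  | Some z, Some w =>
      2 * cabs (z - w) / Num.sqrt ((1 + cabs z ^+ 2) * (1 + cabs w ^+ 2))
  | Some z, None => 2 / Num.sqrt (1 + cabs z ^+ 2)
  | None, Some w => 2 / Num.sqrt (1 + cabs w ^+ 2)
  | None, None => 0
  end.

Definition sphere_open (R : realType) (U : sphere R -> Prop) : Prop :=
  forall x, U x -> exists r : R, 0 < r /\ forall y, chordal x y < r -> U y.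

Definition loc_unif_cvg (R : realType) (U : sphere R -> Prop)
    (f : nat -> sphere R -> sphere R) (g : sphere R -> sphere R) : Prop :=
  forall x, U x -> exists r : R, 0 < r /\ (forall y, chordal x y < r -> U y) /\
    forall eps : R, 0 < eps -> exists N : nat, forall n : nat, (N <= n)%N ->
      forall y, chordal x y < r -> chordal (f n y) (g y) < eps.

Definition iterates_normal_on (R : realType) (F : sphere R -> sphere R)
    (U : sphere R -> Prop) : Prop :=
  forall k : nat -> nat, exists (s : nat -> nat) (g : sphere R -> sphere R),
    (forall n, (s n < s n.+1)%N) /\
    loc_unif_cvg U (fun n => iter (k (s n)) F) g.

Definition fatou (R : realType) (F : sphere R -> sphere R) (x : sphere R) : Prop :=
  exists U : sphere R -> Prop, sphere_open U /\ U x /\ iterates_normal_on F U.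

Definition julia (R : realType) (F : sphere R -> sphere R) (x : sphere R) : Prop :=
  ~ fatou F x.

(* The relaxed Newton map N_{h,p}(z) = z - h p(z)/p'(z) as a self-map of the
   Riemann sphere: at zeros of p' that are roots of p (multiple roots) the
   removable singularity gives N(z) = z; at other zeros of p' it is a pole;
   N(∞) = ∞ (valid whenever h <> deg p, in particular under |h - μ| < μ). *)
Definition relaxed_newton (R : realType) (h : R[i]) (p : {poly R[i]})
    (x : sphere R) : sphere R :=
  match x with
  | None => None
  | Some z =>
      if p^`().[z] != 0 then Some (z - h * p.[z] / p^`().[z])
      else if p.[z] == 0 then Some z else None
  end.

Definition is_line_with_infty (R : realType) (J : sphere R -> Prop) : Prop :=
  exists a d : R[i], d != 0 /\
    forall x, J x <-> (x = None \/ exists t : R, x = Some (a + Complex t 0 * d)).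

(* Main.v *)
Require Import Defs.
From mathcomp Require Import all_boot all_order all_algebra.
From mathcomp Require Import reals boolp.
From mathcomp.real_closed Require Import complex.
From mathcomp Require Import ring lra zify.
Set Implicit Arguments.
Unset Strict Implicit.
Unset Printing Implicit Defensive.
Import Order.TTheory GRing.Theory Num.Theory.
Local Open Scope ring_scope.

(* With multiplicities m, n at the roots a, b, the map is
   N(z) = z - h (z - a) (z - b) / (m (z - b) + n (z - a)), and w = (z - a) / (z - b)
   conjugates it to w (n w + m - h) / ((n - h) w + m).

   If m = n and h is real this is the Blaschke product w (w + c) / (1 + c w) with
   c = 1 - h / m in ]-1, 1[: it contracts |w| <= r < 1 and |w| >= 1 / r, so the two sides of
   the perpendicular bisector |w| = 1 are Fatou, and on the bisector a limit of iterates would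
   have to take both values a and b.

   Conversely, the Julia set is forward invariant, so N maps a Julia line to itself; hence N
   commutes with the reflection in that line, at first on the line and then, being rational,
   everywhere. Comparing the two cubics obtained by clearing denominators, the leading
   coefficients give h real, the zero at a (which is attracting, hence not on the line) gives
   that b is the reflection of a, and then m = n. *)

(** * Modulus and chordal metric *)

Lemma normc_cabs (R : realType) (z : R[i]) : `|z| = (cabs z)%:C%C.
Proof. exact: normc_def. Qed.

Lemma cabs_ge0 (R : realType) (z : R[i]) : 0 <= cabs z.
Proof. exact: sqrtr_ge0. Qed.

Lemma cabs0 (R : realType) : cabs (0 : R[i]) = 0.
Proof. by apply: complexI; rewrite -normc_cabs normr0. Qed.

Lemma cabs_eq0 (R : realType) (z : R[i]) : (cabs z == 0) = (z == 0).
Proof.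
rewrite -[RHS]normr_eq0 normc_cabs.
by apply/eqP/eqP => [->|] //; apply: (@complexI R).
Qed.

Lemma cabs_gt0 (R : realType) (z : R[i]) : (0 < cabs z) = (z != 0).
Proof. by rewrite lt_def cabs_eq0 cabs_ge0 andbT. Qed.

Lemma cabsM (R : realType) (z w : R[i]) : cabs (z * w) = cabs z * cabs w.
Proof.
by apply: complexI; rewrite rmorphM /= -!normc_cabs normrM. Qed.

Lemma cabsV (R : realType) (z : R[i]) : cabs z^-1 = (cabs z)^-1.
Proof. by apply: complexI; rewrite fmorphV /= -!normc_cabs normfV. Qed.

Lemma cabsN (R : realType) (z : R[i]) : cabs (- z) = cabs z.
Proof. by apply: complexI; rewrite -!normc_cabs normrN. Qed.

Lemma cabsB (R : realType) (z w : R[i]) : cabs (z - w) = cabs (w - z).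
Proof. by rewrite -cabsN opprB. Qed.

Lemma cabs_triangle (R : realType) (z w : R[i]) : cabs (z + w) <= cabs z + cabs w.
Proof. by rewrite -lecR rmorphD /= -!normc_cabs ler_normD. Qed.

Lemma cabs_natr (R : realType) (n : nat) : cabs (n%:R : R[i]) = n%:R.
Proof. by apply: complexI; rewrite -normc_cabs normr_nat rmorph_nat. Qed.

Lemma cabs_real (R : realType) (x : R) : cabs x%:C%C = `|x|.
Proof. by rewrite /cabs /= expr0n addr0 sqrtr_sqr. Qed.

Lemma cabs_triangleB (R : realType) (x y z : R[i]) :
  cabs (x - z) <= cabs (x - y) + cabs (y - z).
Proof. by rewrite (le_trans _ (cabs_triangle _ _)) // subrKA. Qed.

Lemma cabs_sub_ge (R : realType) (x y : R[i]) : cabs x - cabs y <= cabs (x + y).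
Proof.
have := cabs_triangle (x + y) (- y); rewrite addrK cabsN; lra.
Qed.

Lemma sqr_cabs (R : realType) (z : R[i]) :
  cabs z ^+ 2 = complex.Re z ^+ 2 + complex.Im z ^+ 2.
Proof. by rewrite sqr_sqrtr // addr_ge0 // sqr_ge0. Qed.

Lemma sqrt1D_ge1 (R : realType) (x : R) : 1 <= Num.sqrt (1 + x ^+ 2).
Proof. by rewrite -{1}sqrtr1 ler_wsqrtr // lerDl sqr_ge0. Qed.

Lemma sqrt1D_le (R : realType) (x : R) : 0 <= x -> Num.sqrt (1 + x ^+ 2) <= 1 + x.
Proof.
move=> x0; rewrite -[leRHS]ger0_norm ?addr_ge0 // -sqrtr_sqr ler_wsqrtr //.
nra.
Qed.

Lemma chordal_sym (R : realType) (x y : sphere R) : chordal x y = chordal y x.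
Proof.
by case: x y => [z|] [w|] //=; rewrite cabsB [(1 + _) * _]mulrC.
Qed.

Lemma chordal_refl (R : realType) (x : sphere R) : chordal x x = 0.
Proof. by case: x => [z|] //=; rewrite subrr cabs0 mulr0 mul0r. Qed.

Lemma chordal_le (R : realType) (z w : R[i]) :
  chordal (Some z) (Some w) <= 2 * cabs (z - w).
Proof.
rewrite /= sqrtrM ?addr_ge0 ?sqr_ge0 //.
have s1 := sqrt1D_ge1 (cabs z); have s2 := sqrt1D_ge1 (cabs w).
rewrite ler_pdivrMr; last by nra.
have d0 := cabs_ge0 (z - w).
by rewrite ler_peMr ?mulr_ge0 //; nra.
Qed.

Lemma chordal_finite (R : realType) (z : R[i]) (e : R) : 0 < e ->
  exists r : R, 0 < r /\ forall y, chordal (Some z) y < r ->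
    exists w, y = Some w /\ cabs (w - z) < e.
Proof.
move=> e0; pose A := 1 + cabs z.
have A1 : 1 <= A by rewrite lerDl cabs_ge0.
have A0 : 0 < A by lra.
(* [A] bounds [Num.sqrt (1 + cabs z ^+ 2)]. The bound [A^-1] excludes infinity and forces
   [cabs (w - z) < A]; the denominator of the chordal distance is then below [2 * A ^+ 2], and
   [e / A ^+ 2] does the rest. *)
exists (Num.min A^-1 (e / A ^+ 2)); split.
  by rewrite lt_min invr_gt0 A0 divr_gt0 // exprn_gt0.
have sA : Num.sqrt (1 + cabs z ^+ 2) <= A by rewrite sqrt1D_le ?cabs_ge0.
have s1 := sqrt1D_ge1 (cabs z).
case=> [w|] /=; rewrite lt_min => /andP[h1 h2]; last first.
  move: h1; rewrite ltr_pdivrMr; last by lra.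
  by rewrite mulrC ltr_pdivlMr //; lra.
exists w; split => //; rewrite cabsB; set d := cabs _ in h1 h2 *.
have s2 := sqrt1D_ge1 (cabs w).
have dw : cabs w <= cabs z + d.
  by rewrite /d cabsB -[X in cabs X <= _](subrK z) addrC cabs_triangle.
have sw : Num.sqrt (1 + cabs w ^+ 2) <= A + d.
  rewrite (le_trans (sqrt1D_le (cabs_ge0 _))) // /A; lra.
have d0 : 0 <= d := cabs_ge0 _.
move: h1 h2; rewrite sqrtrM ?addr_ge0 ?sqr_ge0 //.
set s := Num.sqrt _ in s1 sA *; set s' := Num.sqrt _ in s2 sw *.
have ss0 : 0 < s * s' by nra.
have ss' : s * s' <= A * (A + d) by nra.
rewrite !ltr_pdivrMr // => h1 h2.
have h3 : 2 * d < A + d.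
  apply: (lt_le_trans h1); rewrite mulrC ler_pdivrMr //; lra.
have h4 : 2 * d * A ^+ 2 < e * (s * s').
  by move: h2; rewrite mulrAC ltr_pdivlMr ?exprn_gt0.
have h5 : 2 * d * A ^+ 2 < e * (A * (2 * A)).
  apply: (lt_le_trans h4); rewrite ler_pM2l //; nra.
have A2 : 0 < A ^+ 2 by rewrite exprn_gt0.
by rewrite -(ltr_pM2r A2); lra.
Qed.

Lemma chordal_infty (R : realType) (M : R) :
  exists r : R, 0 < r /\ forall w : R[i], chordal None (Some w) < r -> M < cabs w.
Proof.
pose B := 1 + `|M|; have B1 : 1 <= B by rewrite lerDl.
have B0 : 0 < B by lra.
exists (2 / B); split; first by rewrite divr_gt0.
move=> w /=; have s1 := sqrt1D_ge1 (cabs w).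
have sw := sqrt1D_le (cabs_ge0 w).
rewrite ltr_pdivrMr; last by lra.
rewrite mulrAC ltr_pdivlMr // ltr_pM2l // => h.
have := ler_norm M; rewrite /B in h; lra.
Qed.

Lemma chordal_infty_lt (R : realType) (e : R) : 0 < e ->
  exists M : R, 0 < M /\ forall w : R[i], M < cabs w -> chordal None (Some w) < e.
Proof.
move=> e0; exists (2 / e); split=> [|w]; first by rewrite divr_gt0.
rewrite ltr_pdivrMr // => h /=; have s1 := sqrt1D_ge1 (cabs w).
rewrite ltr_pdivrMr; last by lra.
apply: (lt_le_trans h); rewrite mulrC ler_pM2l //.
rewrite -[leLHS]ger0_norm ?cabs_ge0 // -sqrtr_sqr ler_wsqrtr //; lra.
Qed.

(** * Continuity on the sphere *)

Definition chordal_continuous (R : realType) (F : sphere R -> sphere R) : Prop :=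
  forall (x : sphere R) (e : R), 0 < e -> exists d : R, 0 < d /\
    forall y, chordal x y < d -> chordal (F x) (F y) < e.

Lemma chordal_continuous_iter (R : realType) (F : sphere R -> sphere R) (n : nat) :
  chordal_continuous F -> chordal_continuous (iter n F).
Proof.
move=> cF; elim: n => [|n IHn] x e e0; first by exists e.
have [d [d0 hd]] := cF (iter n F x) e e0.
have [d' [d'0 hd']] := IHn x d d0.
by exists d'; split=> // y /hd' /hd.
Qed.

(** The nonzero linear part dominates near infinity and the nonzero residue [f] near [c]; elsewhere
    the map is locally Lipschitz. *)
Lemma chordal_continuous_partial_fraction (R : realType) (A e f c : R[i])
    (F : sphere R -> sphere R) :
  A != 0 -> f != 0 -> F None = None -> F (Some c) = None ->
  (forall z, z != c -> F (Some z) = Some (A * z + e + f / (z - c))) ->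
  chordal_continuous F.
Proof.
rewrite -cabs_gt0 => A0; rewrite -cabs_gt0 => f0 Foo Fc Fz.
have e0 := cabs_ge0 e; have c0 := cabs_ge0 c.
case=> [z|] eps eps0; last first.
  have [M [M0 hM]] := chordal_infty_lt eps0.
  have q0 : 0 <= (M + cabs e + cabs f) / cabs A by rewrite divr_ge0 ?ltW //; lra.
  have [r [r0 hr]] := chordal_infty (cabs c + 1 + (M + cabs e + cabs f) / cabs A).
  exists r; split=> // -[w|]; last by rewrite Foo chordal_refl.
  move=> /hr hw; have wc : 1 < cabs (w - c).
    by have := cabs_sub_ge w (- c); rewrite cabsN; lra.
  have wc0 : w != c by rewrite -subr_eq0 -cabs_gt0; lra.
  rewrite Foo Fz //; apply: hM.
  have fw : cabs (f / (w - c)) <= cabs f.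
    rewrite cabsM cabsV ler_pdivrMr ?ler_peMr //; lra.
  have : (M + cabs e + cabs f) / cabs A < cabs w by lra.
  rewrite ltr_pdivrMr // mulrC -cabsM => Aw.
  have := cabs_sub_ge (A * w + e) (f / (w - c)).
  by have := cabs_sub_ge (A * w) e; lra.
have [->|zc] := eqVneq z c.
  have [M [M0 hM]] := chordal_infty_lt eps0.
  pose K := cabs A * (cabs c + 1) + cabs e + M.
  have K0 : 0 < K by rewrite /K; nra.
  have d0 : 0 < Num.min 1 (cabs f / K) by rewrite lt_min ltr01 divr_gt0.
  have [r [r0 hr]] := chordal_finite c d0.
  exists r; split=> // y /hr[w [-> ]]; rewrite lt_min => /andP[h1 h2].
  have [->|wc] := eqVneq w c; first by rewrite Fc chordal_refl.
  rewrite Fc Fz //; apply: hM.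
  have wc0 : 0 < cabs (w - c) by rewrite cabs_gt0 subr_eq0.
  have fw : K < cabs (f / (w - c)).
    by rewrite cabsM cabsV ltr_pdivlMr // mulrC -ltr_pdivlMr.
  have hw : cabs w < cabs c + 1.
    by have := cabs_triangle (w - c) c; rewrite subrK; lra.
  have Aw : cabs (A * w) < cabs A * (cabs c + 1) by rewrite cabsM ltr_pM2l.
  have := cabs_triangle (A * w) e.
  have := cabs_sub_ge (f / (w - c)) (A * w + e).
  by rewrite [f / _ + _]addrC /K in fw *; lra.
have g0 : 0 < cabs (z - c) by rewrite cabs_gt0 subr_eq0.
set g := cabs (z - c) in g0.
(* [L] is a Lipschitz constant between [z] and points within [g / 2] of it, which stay at distance
   at least [g / 2] from the pole. *)
pose L := cabs A + cabs f / (g * (g / 2)).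
have gg : 0 < g * (g / 2) by rewrite !mulr_gt0 // invr_gt0.
have L0 : 0 < L by rewrite /L addr_gt0 // divr_gt0.
have d0 : 0 < Num.min (g / 2) (eps / (2 * L)).
  by rewrite lt_min !divr_gt0 // mulr_gt0.
have [r [r0 hr]] := chordal_finite z d0.
exists r; split=> // y /hr[w [-> ]]; rewrite lt_min => /andP[h1 h2].
have wg : g / 2 <= cabs (w - c).
  have := cabs_triangleB z w c; rewrite (cabsB z w) -/g; lra.
have wc : w != c by rewrite -subr_eq0 -cabs_gt0; lra.
rewrite !Fz //; apply: (le_lt_trans (chordal_le _ _)).
move: h2; rewrite ltr_pdivlMr ?mulr_gt0 // => h2.
have wc' : w - c != 0 by rewrite subr_eq0.
have zc' : z - c != 0 by rewrite subr_eq0.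
have -> : A * z + e + f / (z - c) - (A * w + e + f / (w - c)) =
   (w - z) * (- A) + (w - z) * (f / ((z - c) * (w - c))).
  by field; rewrite wc' zc'.
have := cabs_triangle ((w - z) * (- A)) ((w - z) * (f / ((z - c) * (w - c)))).
rewrite !cabsM cabsN cabsV cabsM -/g.
have : cabs f / (g * cabs (w - c)) <= cabs f / (g * (g / 2)).
  rewrite ler_pM2l // lef_pV2 ?posrE // ?mulr_gt0 ?ler_pM2l //; lra.
have := cabs_ge0 (w - z).
by rewrite /L in h2; nra.
Qed.

(** * Subsequences and normal families *)

Lemma increasing_ge_id (s : nat -> nat) :
  (forall n, (s n < s n.+1)%N) -> forall n, (n <= s n)%N.
Proof. by move=> hs; elim=> // n IHn; apply: leq_ltn_trans IHn (hs n). Qed.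

Lemma increasing_homo (s : nat -> nat) :
  (forall n, (s n < s n.+1)%N) -> forall m n, (m < n)%N -> (s m < s n)%N.
Proof.
move=> hs m n; apply: (@homo_ltn nat s (fun x y => (x < y)%N)) => //.
exact: ltn_trans.
Qed.

Lemma increasing_choice (P : nat -> nat -> Prop) :
  (forall i N, exists n, (N <= n)%N /\ P i n) ->
  exists s : nat -> nat, (forall n, (s n < s n.+1)%N) /\ forall i, P i (s i).
Proof.
move=> hP; have [f hf] := choice (fun iN : nat * nat => hP iN.1 iN.2).
pose s := fix s i := if i is j.+1 then f (i, (s j).+1) else f (0%N, 0%N).
exists s; split=> [n|i]; first by have [] := hf (n.+1, (s n).+1).
by case: i => [|i]; [have [] := hf (0, 0)%N | have [] := hf (i.+1, (s i).+1)].
Qed.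

(** Either every threshold is reached arbitrarily late, or a tail is bounded; in the second case, by
    induction on the bound, some value recurs infinitely often. *)
Lemma nat_sequence_dichotomy (k : nat -> nat) :
  exists s : nat -> nat, (forall n, (s n < s n.+1)%N) /\
    ((forall n, (n <= k (s n))%N) \/ exists v, forall n, k (s n) = v).
Proof.
have [hk|] := pselect (forall i N, exists n, (N <= n)%N /\ (i <= k n)%N).
  by have [s [hs hks]] := increasing_choice hk; exists s; split=> //; left.
move=> /existsNP[M /existsNP[N0 hN]].
have {hN} hk : forall n, (N0 <= n)%N -> (k n < M)%N.
  by move=> n hn; rewrite ltnNge; apply/negP => hM; apply: hN; exists n.
elim: M N0 hk => [|M IHM] N0 hk; first by have := hk _ (leqnn _).
have [hM|] := pselect (forall i N : nat, exists n, (N <= n)%N /\ k n = M).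
  have [s [hs hks]] := increasing_choice hM.
  by exists s; split=> //; right; exists M.
move=> /existsNP[_ /existsNP[N1 hN]].
apply: (IHM (maxn N0 N1)) => n; rewrite geq_max => /andP[h0 h1].
have := hk n h0; rewrite ltnS leq_eqVlt => /orP[/eqP kM|//].
by exfalso; apply: hN; exists n.
Qed.

(* The index sequence [k] is arbitrary, so besides the escaping case a constant subsequence
   must be allowed; it converges trivially. *)
Lemma iterates_normal_escaping (R : realType) (F : sphere R -> sphere R)
    (U : sphere R -> Prop) :
  sphere_open U ->
  (forall k : nat -> nat, (forall n, (n <= k n)%N) ->
    exists (s : nat -> nat) (g : sphere R -> sphere R),
      (forall n, (s n < s n.+1)%N) /\ loc_unif_cvg U (fun n => iter (k (s n)) F) g) ->
  iterates_normal_on F U.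
Proof.
move=> oU hU k; have [s [hs [hk|[v hv]]]] := nat_sequence_dichotomy k.
  have [s' [g [hs' hg]]] := hU (k \o s) hk.
  by exists (s \o s'), g; split=> // n; apply: (increasing_homo hs).
exists s, (iter v F); split=> // x /oU[r [r0 hr]].
exists r; split=> //; split=> // e e0; exists 0%N => n _ y _.
by rewrite hv chordal_refl.
Qed.

(** Iterates at [x] are iterates at [F x] with one step less, and continuity pulls neighbourhoods
    back. The contrapositive is forward invariance of the Julia set. *)
Lemma fatou_preimage (R : realType) (F : sphere R -> sphere R) (x : sphere R) :
  chordal_continuous F -> fatou F (F x) -> fatou F x.
Proof.
move=> cF [U [oU [Ux nU]]].
have oV : sphere_open (fun y => U (F y)).
  move=> y /oU[r [r0 hr]]; have [d [d0 hd]] := cF y r r0.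
  by exists d; split=> // w /hd /hr.
exists (fun y => U (F y)); split=> //; split=> //.
apply: iterates_normal_escaping => // k hk.
have [s [g [hs hg]]] := nU (fun n => (k n).-1).
(* The shift by [S] starts the subsequence at [s 1 >= 1], where the exponent [k] is positive, so
   that one [F] can be split off. *)
exists (s \o S), (g \o F); split=> [n|y Uy] /=; first exact: hs.
have [r [r0 [hrU hr]]] := hg _ Uy.
have [d [d0 hd]] := cF y r r0.
exists d; split=> //; split=> [w /hd /hrU //|e e0].
have [N hN] := hr e e0; exists N => n Nn w /hd hw.
have := hN n.+1 (leqW Nn) _ hw; rewrite -iterSr prednK //.
exact: leq_trans (leq_trans (ltn0Sn _) (increasing_ge_id hs n.+1)) (hk _).
Qed.

(** * Contraction of the ratio of distances *)

Lemma exprn_bernoulli (R : realType) (k : R) (n : nat) : 0 <= k <= 1 ->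
  k ^+ n * (1 + n%:R * (1 - k)) <= 1.
Proof.
move=> /andP[k0 k1]; elim: n => [|n IHn]; first by rewrite expr0; lra.
apply: le_trans IHn; rewrite exprSr -mulrA ler_wpM2l ?exprn_ge0 //.
have : 0 <= (n%:R + 1) * (1 - k) ^+ 2 :> R by rewrite mulr_ge0 ?sqr_ge0 ?addr_ge0.
by rewrite -natr1; lra.
Qed.

Lemma exprn_small (R : realType) (k e : R) : 0 <= k < 1 -> 0 < e ->
  exists N : nat, forall n, (N <= n)%N -> k ^+ n < e.
Proof.
move=> /andP[k0 k1] e0; have d0 : 0 < e * (1 - k) by nra.
exists (Num.bound (e * (1 - k))^-1) => n hn.
have hb : (e * (1 - k))^-1 < n%:R.
  apply: (lt_le_trans (archi_boundP _)); last by rewrite ler_nat.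
  by rewrite invr_ge0 ltW.
have h1 : 1 < n%:R * (e * (1 - k)) by rewrite -ltr_pdivrMr // mul1r.
have := @exprn_bernoulli _ k n; rewrite k0 ltW // => /(_ isT) h2.
have := exprn_ge0 n k0; rewrite ltNge => kn; apply/negP => ek.
have n0 : 0 <= n%:R :> R by [].
have : 1 + n%:R * (1 - k) <= e^-1.
  rewrite -[leRHS]mul1r ler_pdivlMr //; apply: le_trans h2.
  by rewrite mulrC ler_wpM2r //; nra.
by rewrite -[leRHS]mul1r ler_pdivlMr //; nra.
Qed.

(** The ratio of [cabs (z - a)] to [cabs (z - b)] is the modulus of the Möbius coordinate vanishing
    at [a]. It is at most [k ^+ n * r] after [n] steps, and a small ratio forces closeness to
    [a]. *)
Lemma ratio_contraction_iter (R : realType) (F : sphere R -> sphere R)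
    (a b : R[i]) (r k : R) :
  0 <= r < 1 -> 0 <= k < 1 ->
  (forall (s : R) (z : R[i]), 0 <= s <= r -> cabs (z - a) <= s * cabs (z - b) ->
    exists w, F (Some z) = Some w /\ cabs (w - a) <= k * s * cabs (w - b)) ->
  forall e : R, 0 < e -> exists N : nat, forall n, (N <= n)%N ->
    forall z, cabs (z - a) <= r * cabs (z - b) ->
    exists w, iter n F (Some z) = Some w /\ cabs (w - a) < e.
Proof.
move=> /andP[r0 r1] /andP[k0 k1] hF e e0.
have hn (n : nat) z : cabs (z - a) <= r * cabs (z - b) ->
    exists w, iter n F (Some z) = Some w /\
      cabs (w - a) <= k ^+ n * r * cabs (w - b).
  move=> hz; elim: n => [|n [w [hw1 hw2]]]; first by exists z; rewrite mul1r.
  have kn0 := exprn_ge0 n k0.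
  have kn1 : k ^+ n <= 1 by rewrite exprn_ile1 // ltW.
  have [|w' [h1 h2]] := hF _ _ _ hw2; first by apply/andP; split; nra.
  by exists w'; rewrite iterS hw1 exprS -[k * _ * r]mulrA.
have ab := cabs_ge0 (a - b).
(* The triangle inequality through [a] turns the ratio bound into [cabs (w - a) * (1 - r) <= k ^+ n
   * cabs (a - b)], which dictates this threshold; the added 1 keeps the denominator positive. *)
have d0 : 0 < e * (1 - r) / (1 + cabs (a - b)).
  by rewrite divr_gt0 ?mulr_gt0 //; lra.
have [|N hN] := @exprn_small _ k _ _ d0; first by rewrite k0.
exists N => n /hN; rewrite ltr_pdivlMr; last lra.
move=> hk z /(hn n)[w [-> hw]]; exists w; split=> //.
have kn0 := exprn_ge0 n k0.
have kn1 : k ^+ n <= 1 by rewrite exprn_ile1 // ltW.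
have wab := cabs_triangleB w a b.
have wa := cabs_ge0 (w - a).
set K := k ^+ n in hk hw kn0 kn1.
have h1 : cabs (w - a) <= K * r * (cabs (w - a) + cabs (a - b)).
  by apply: (le_trans hw); rewrite ler_wpM2l //; nra.
have h2 : cabs (w - a) * (1 - r) <= K * cabs (a - b).
  have : K * r * cabs (w - a) <= r * cabs (w - a) by rewrite ler_wpM2r //; nra.
  have : K * r * cabs (a - b) <= K * cabs (a - b) by rewrite ler_wpM2r //; nra.
  lra.
have h3 : cabs (w - a) * (1 - r) < e * (1 - r) by nra.
by move: h3; rewrite ltr_pM2r //; lra.
Qed.

(** The set of ratio below [r] is open, and there the iterates converge uniformly to the constant
    [a]. *)
Lemma ratio_contraction_fatou (R : realType) (F : sphere R -> sphere R)
    (a b : R[i]) (r k : R) (z : R[i]) :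
  0 <= r < 1 -> 0 <= k < 1 ->
  (forall (s : R) (z : R[i]), 0 <= s <= r -> cabs (z - a) <= s * cabs (z - b) ->
    exists w, F (Some z) = Some w /\ cabs (w - a) <= k * s * cabs (w - b)) ->
  cabs (z - a) < r * cabs (z - b) -> fatou F (Some z).
Proof.
move=> r01 k01 hF hz.
pose U (x : sphere R) : Prop :=
  if x is Some w then is_true (cabs (w - a) < r * cabs (w - b)) else False.
have oU : sphere_open U.
  case=> [w|//] /= hw.
  have d0 : 0 < (r * cabs (w - b) - cabs (w - a)) / 2 by lra.
  have [d [dd hd]] := chordal_finite w d0.
  exists d; split=> // _ /hd[w' [-> hw']] /=; case/andP: r01 => r0 r1.
  have := cabs_triangleB w' w a; have := cabs_triangleB w w' b.
  rewrite (cabsB w w') => h1 h2.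
  have : r * cabs (w - b) <= r * (cabs (w' - w) + cabs (w' - b)) by rewrite ler_wpM2l.
  have := cabs_ge0 (w' - w); nra.
exists U; split=> //; split=> //.
apply: iterates_normal_escaping => // j hj.
exists id, (fun=> Some a); split=> // x Ux.
have [d [d0 hd]] := oU _ Ux; exists d; split=> //; split=> // e e0.
have e2 : 0 < e / 2 by lra.
have [N hN] := ratio_contraction_iter r01 k01 hF e2.
exists N => n Nn y /hd; case: y => [y|//] /ltW hy.
have [w [-> hw]] := hN _ (leq_trans Nn (hj n)) _ hy.
by apply: (le_lt_trans (chordal_le _ _)); lra.
Qed.

(** * Explicit form of the Newton map for two roots *)

Lemma prod_XsubC_two_roots (K : fieldType) (a b : K) (r : seq K) : a != b ->
  {subset r <= [:: a; b]} ->
  \prod_(z <- r) ('X - z%:P) =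
    ('X - a%:P) ^+ count_mem a r * ('X - b%:P) ^+ count_mem b r.
Proof.
move=> ab; elim: r => [|z r IHr] rab; first by rewrite big_nil !expr0 mulr1.
rewrite big_cons IHr => [|x xr]; last by apply: rab; rewrite inE xr orbT.
have := rab z; rewrite mem_head !inE => /(_ isT) /orP[] /eqP-> /=.
  by rewrite eqxx (negPf ab) add0n add1n exprS mulrA.
by rewrite eqxx eq_sym (negPf ab) add0n add1n exprS mulrCA.
Qed.

Lemma two_roots_factor (K : closedFieldType) (p : {poly K}) (a b : K) :
  p != 0 -> a != b -> (forall z, root p z <-> (z = a \/ z = b)) ->
  p = lead_coef p *: (('X - a%:P) ^+ mup a p * ('X - b%:P) ^+ mup b p).
Proof.
move=> p0 ab rp; have [r pE] := closed_field_poly_normal p.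
have c0 : lead_coef p != 0 by rewrite lead_coef_eq0.
have rab : {subset r <= [:: a; b]}.
  move=> z zr; have /rp[] : root p z by rewrite pE rootZ // root_prod_XsubC.
    by move=> ->; rewrite mem_head.
  by move=> ->; rewrite !inE eqxx orbT.
have mupE x : mup x p = count_mem x r.
  rewrite pE -mul_polyC mupMr ?mu_prod_XsubC //.
  by rewrite rootC.
by rewrite {1}pE (prod_XsubC_two_roots ab rab) !mupE.
Qed.

(* [m (z - b) + n (z - a)] is [p' / p] times [(z - a) (z - b)] when [p] has roots [a], [b]
   of multiplicities [m], [n]. *)
Definition two_root_newton (R : realType) (m n : nat) (h a b : R[i])
    (F : sphere R -> sphere R) : Prop :=
  [/\ F None = None,
      forall z, m%:R * (z - b) + n%:R * (z - a) = 0 -> F (Some z) = None &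
      forall z, m%:R * (z - b) + n%:R * (z - a) != 0 ->
        F (Some z) =
          Some (z - h * (z - a) * (z - b) / (m%:R * (z - b) + n%:R * (z - a)))].

Lemma two_root_newton_sym (R : realType) (m n : nat) (h a b : R[i])
    (F : sphere R -> sphere R) :
  two_root_newton m n h a b F -> two_root_newton n m h b a F.
Proof.
move=> [F0 F1 F2]; split=> // z; first by rewrite addrC => /F1.
by rewrite addrC => /F2 ->; rewrite [h * _ * _]mulrAC.
Qed.

Lemma horner_two_roots (K : comNzRingType) (c a b z : K) (m n : nat) :
  (c *: (('X - a%:P) ^+ m * ('X - b%:P) ^+ n)).[z] =
    c * ((z - a) ^+ m * (z - b) ^+ n).
Proof. by rewrite hornerZ hornerM !horner_exp !hornerXsubC. Qed.

Lemma deriv_horner_two_roots (K : comNzRingType) (c a b z : K) (m n : nat) :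
  (0 < m)%N -> (0 < n)%N ->
  (c *: (('X - a%:P) ^+ m * ('X - b%:P) ^+ n))^`().[z] =
    c * ((z - a) ^+ m.-1 * (z - b) ^+ n.-1 * (m%:R * (z - b) + n%:R * (z - a))).
Proof.
case: m n => // m [//|n] _ _ /=.
rewrite derivZ derivM !deriv_exp !derivXsubC !mul1r hornerZ hornerD !hornerM !hornerMn.
rewrite !horner_exp !hornerXsubC /= !exprS.
rewrite -(mulr_natl ((z - a) ^+ m)) -(mulr_natl ((z - b) ^+ n)); ring.
Qed.

(** At a multiple root [p'] vanishes but the reduced denominator does not, so the two case
    distinctions differ; both maps fix the roots, and elsewhere the common factor of [p] and [p']
    cancels. *)
Lemma relaxed_newton_two_roots (R : realType) (c a b h : R[i]) (m n : nat) :
  c != 0 -> a != b -> (0 < m)%N -> (0 < n)%N ->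
  two_root_newton m n h a b
    (relaxed_newton h (c *: (('X - a%:P) ^+ m * ('X - b%:P) ^+ n))).
Proof.
move=> c0 ab m0 n0; set p := _ *: _.
have pz z := horner_two_roots c a b z m n.
have dpz z := deriv_horner_two_roots c a b z m0 n0.
rewrite -/p in pz dpz; move: p pz dpz => p pz dpz.
split=> // z.
  move=> Dz; rewrite /= dpz Dz !mulr0 eqxx /= ifF //; apply/negbTE.
  have mK : (m%:R : R[i]) != 0 by rewrite pnatr_eq0 -lt0n.
  have nK : (n%:R : R[i]) != 0 by rewrite pnatr_eq0 -lt0n.
  rewrite pz; apply: mulf_neq0 => //; apply: mulf_neq0; apply: expf_neq0.
    rewrite subr_eq0; apply: contra_neq ab => za; move: Dz.
    by rewrite za subrr mulr0 addr0 => /eqP; rewrite mulf_eq0 (negPf mK) subr_eq0 => /eqP.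
  rewrite subr_eq0; apply: contra_neq ab => za; move: Dz.
  by rewrite za subrr mulr0 add0r => /eqP; rewrite mulf_eq0 (negPf nK) subr_eq0 => /eqP.
move=> Dz; have [pz0|pz0] := eqVneq p.[z] 0.
  have -> : relaxed_newton h p (Some z) = Some z.
    by rewrite /= pz0 eqxx mulr0 mul0r subr0 if_same.
  move/eqP: pz0; rewrite pz !mulf_eq0 (negPf c0) !expf_eq0 m0 n0 /=.
  by case/orP => /eqP ->; rewrite !(mulr0, mul0r) subr0.
have za : z - a != 0.
  by apply: contra_neq pz0 => za; rewrite pz za expr0n gtn_eqF //= mul0r mulr0.
have zb : z - b != 0.
  by apply: contra_neq pz0 => zb; rewrite pz zb expr0n gtn_eqF //= !mulr0.
have zam : (z - a) ^+ m.-1 != 0 by apply: expf_neq0.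
have zbn : (z - b) ^+ n.-1 != 0 by apply: expf_neq0.
have dp0 : p^`().[z] != 0 by rewrite dpz mulf_neq0 // mulf_neq0 // mulf_neq0.
rewrite /= dp0; congr (Some (z - _)); rewrite pz dpz.
rewrite -{1}(prednK m0) -{1}(prednK n0) !exprS.
move: zam zbn Dz; set u := _ ^+ _; set v := _ ^+ _; set D := _ + _ => zam zbn Dz.
by field; rewrite Dz c0 zam zbn.
Qed.

Lemma two_root_newton_continuous (R : realType) (m n : nat) (h a b : R[i])
    (F : sphere R -> sphere R) :
  two_root_newton m n h a b F -> (0 < m)%N -> (0 < n)%N -> a != b ->
  h != 0 -> h != (m + n)%:R -> chordal_continuous F.
Proof.
move=> [F0 F1 F2] m0 n0 ab h0 hs.
have mK : (m%:R : R[i]) != 0 by rewrite pnatr_eq0 -lt0n.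
have nK : (n%:R : R[i]) != 0 by rewrite pnatr_eq0 -lt0n.
have sK : (m%:R + n%:R : R[i]) != 0 by rewrite -natrD pnatr_eq0 addn_eq0 negb_and -!lt0n m0.
(* [c] is the finite pole. Dividing [(z - a) * (z - b)] by [z - c] gives the partial fraction below:
   its linear coefficient vanishes only for [h = m + n], and its residue is nonzero since [h != 0]
   and [c] is neither root. *)
pose s : R[i] := m%:R + n%:R; pose c := (m%:R * b + n%:R * a) / s.
have DE z : m%:R * (z - b) + n%:R * (z - a) = s * (z - c) by rewrite /c /s; field.
have ab' : a - b != 0 by rewrite subr_eq0.
apply: (@chordal_continuous_partial_fraction _ (1 - h / s) (h / s * (a + b - c))
  (- (h / s * ((c - a) * (c - b)))) c) => //.
- rewrite subr_eq0 eq_sym; apply: contra_neq hs => hs.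
  by rewrite natrD -/s -[LHS](divfK (sK : s != 0)) hs mul1r.
- have -> : - (h / s * ((c - a) * (c - b))) = h * m%:R * n%:R * (a - b) ^+ 2 / s ^+ 3.
    by rewrite /c /s; field.
  by rewrite !mulf_neq0 // invr_eq0 expf_neq0.
- by apply: F1; rewrite DE subrr mulr0.
move=> z zc; have zc' : z - c != 0 by rewrite subr_eq0.
rewrite F2 ?DE ?mulf_neq0 //; congr Some.
by field; rewrite zc' sK.
Qed.

(** * Attraction to the roots *)

(** With [D] the denominator, [F z - a] is [(z - a) * X / D] and [F z - b] is [(z - b) * Y / D], so
    the ratio gets multiplied by [X / Y], the quotient bounded by [k] in the hypothesis. *)
Lemma two_root_newton_contraction (R : realType) (m n : nat) (h a b : R[i])
    (F : sphere R -> sphere R) (r k : R) :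
  two_root_newton m n h a b F -> 0 <= k ->
  (forall z, cabs (z - a) <= r * cabs (z - b) ->
    m%:R * (z - b) + n%:R * (z - a) != 0 /\
    cabs ((m%:R - h) * (z - b) + n%:R * (z - a)) <=
      k * cabs (m%:R * (z - b) + (n%:R - h) * (z - a))) ->
  forall (s : R) (z : R[i]), 0 <= s <= r -> cabs (z - a) <= s * cabs (z - b) ->
    exists w, F (Some z) = Some w /\ cabs (w - a) <= k * s * cabs (w - b).
Proof.
move=> [F0 F1 F2] k0 hr s z /andP[s0 sr] hz.
have [|Dz hk] := hr z.
  by apply: (le_trans hz); rewrite ler_wpM2r ?cabs_ge0.
rewrite F2 //; set D := _ + _ in Dz *.
set X := (X in cabs X <= _) in hk; set Y := (X in _ <= _ * cabs X) in hk.
eexists; split; first by [].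
have -> : z - h * (z - a) * (z - b) / D - a = (z - a) * X / D.
  by rewrite /X /D; field; exact: Dz.
have -> : z - h * (z - a) * (z - b) / D - b = (z - b) * Y / D.
  by rewrite /Y /D; field; exact: Dz.
rewrite !cabsM !cabsV !mulrA ler_pM2r ?invr_gt0 ?cabs_gt0 //.
have -> : k * s * cabs (z - b) * cabs Y = (s * cabs (z - b)) * (k * cabs Y) by ring.
by rewrite ler_pM ?cabs_ge0.
Qed.

(** Near [a] the terms in [z - a] are negligible, so the ratio is multiplied by nearly
    [(m - h) / m], the multiplier of the fixed point [a]. *)
Lemma two_root_newton_fatou_root (R : realType) (m n : nat) (h a b : R[i])
    (F : sphere R -> sphere R) :
  two_root_newton m n h a b F -> a != b ->
  cabs (h - m%:R) < m%:R -> cabs (h - n%:R) < n%:R -> fatou F (Some a).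
Proof.
move=> FN ab hm hn; rewrite cabsB in hm; rewrite cabsB in hn.
have q0 := cabs_ge0 (m%:R - h); have q1 := cabs_ge0 (n%:R - h).
set q := cabs (m%:R - h) in hm q0; set q' := cabs _ in hn q1.
have M0 : 0 < m%:R :> R by lra.
have N0 : 0 < n%:R :> R by lra.
(* [d] is the gap in [q < m]. The choice of [r] gives [n * cabs (z - a) <= d / 4 * cabs (z - b)];
   numerator and denominator are then at most [m - 3 d / 4] and at least [m - d / 4] times
   [cabs (z - b)], whence [k]. *)
pose d : R := m%:R - q; pose r : R := d / (4 * (m%:R + n%:R)).
have d0 : 0 < d by rewrite /d; lra.
have s0 : 0 < 4 * (m%:R + n%:R) :> R by lra.
have r0 : 0 < r by rewrite divr_gt0.
have rE : r * (4 * (m%:R + n%:R)) = d by rewrite divfK // gt_eqF.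
have r1 : r < 1 by rewrite ltr_pdivrMr // /d; lra.
have nr : n%:R * r <= d / 4 by nra.
have y0 : 0 < m%:R - d / 4 by rewrite /d; lra.
pose k : R := (m%:R - 3 * d / 4) / (m%:R - d / 4).
have k0 : 0 <= k by rewrite divr_ge0 // /d; lra.
have k1 : k < 1 by rewrite ltr_pdivrMr //; lra.
apply: (@ratio_contraction_fatou _ _ _ b r k); rewrite ?k0 ?k1 ?r1 ?(ltW r0) //.
  apply: (two_root_newton_contraction FN k0) => z hz.
  have zb : 0 < cabs (z - b).
    rewrite cabs_gt0 subr_eq0; apply: contraNneq ab => zb; move: hz.
    rewrite zb subrr cabs0 mulr0 => h0.
    by rewrite -subr_eq0 -cabs_eq0 eq_le cabs_ge0 cabsB h0.
  have nz : n%:R * cabs (z - a) <= d / 4 * cabs (z - b).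
    apply: (@le_trans _ _ (n%:R * (r * cabs (z - b)))); first by rewrite ler_pM2l.
    by rewrite mulrA ler_pM2r.
  split.
    rewrite -cabs_gt0; apply: lt_le_trans (cabs_sub_ge _ _).
    by rewrite !cabsM !cabs_natr /d in nz *; nra.
  apply: (@le_trans _ _ ((m%:R - 3 * d / 4) * cabs (z - b))).
    apply: (le_trans (cabs_triangle _ _)); rewrite !cabsM cabs_natr -/q.
    by rewrite /d in nz *; nra.
  rewrite -[X in X * cabs _ <= _](divfK (lt0r_neq0 y0)) -/k -mulrA ler_wpM2l //.
  apply: le_trans (cabs_sub_ge _ _); rewrite !cabsM cabs_natr -/q'.
  have : q' * cabs (z - a) <= n%:R * cabs (z - a) by rewrite ler_wpM2r ?cabs_ge0 // ltW.
  lra.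
by rewrite subrr cabs0 mulr_gt0 // cabs_gt0 subr_eq0.
Qed.

(** * Rigidity from an invariant line *)

(** The primed letters stand for conjugates in a coordinate that makes the line real. The difference
    of both sides is a cubic, determined by its values at 0, 1, 2, 3. *)
Lemma reflection_rigidity (K : numFieldType) (m n : nat) (h h' x x' y y' : K) :
  (0 < m)%N -> (0 < n)%N -> h != 0 -> x != y -> x != x' ->
  (forall j : nat,
    h * (j%:R - x) * (j%:R - y) * (m%:R * (j%:R - y') + n%:R * (j%:R - x')) =
    h' * (j%:R - x') * (j%:R - y') * (m%:R * (j%:R - y) + n%:R * (j%:R - x))) ->
  h = h' /\ m = n.
Proof.
move=> m0 n0 h0 xy xx' H.
pose G t := h * (t - x) * (t - y) * (m%:R * (t - y') + n%:R * (t - x')) -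
  h' * (t - x') * (t - y') * (m%:R * (t - y) + n%:R * (t - x)).
have GH (j : nat) : G j%:R = 0 by apply/eqP; rewrite subr_eq0; apply/eqP/H.
have mK : (m%:R : K) != 0 by rewrite pnatr_eq0 -lt0n.
have sK : (m%:R + n%:R : K) != 0.
  by rewrite -natrD pnatr_eq0 addn_eq0 negb_and -!lt0n m0.
have hh' : h = h'.
  (* the third difference of a cubic isolates its leading coefficient *)
  have : G 3%:R - 3%:R * G 2%:R + 3%:R * G 1%:R - G 0%:R =
    6%:R * (m%:R + n%:R) * (h - h') by rewrite /G; ring.
  rewrite !GH !(mulr0, addr0, subr0) => /esym/eqP.
  by rewrite !mulf_eq0 (negPf sK) pnatr_eq0 /= subr_eq0 => /eqP.
split=> //.
(* Lagrange interpolation at 0, 1, 2, 3. *)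
have G0 t : G t = 0.
  have -> : G t = - G 0%:R * (t - 1) * (t - 2%:R) * (t - 3%:R) / 6%:R
     + G 1%:R * t * (t - 2%:R) * (t - 3%:R) / 2%:R
     - G 2%:R * t * (t - 1) * (t - 3%:R) / 2%:R
     + G 3%:R * t * (t - 1) * (t - 2%:R) / 6%:R.
    by rewrite /G; field.
  by rewrite !GH !(oppr0, mul0r, addr0, subr0).
have xy0 : x - y != 0 by rewrite subr_eq0.
have xx0 : x - x' != 0 by rewrite subr_eq0.
(* At [x] the first product vanishes, leaving [x - y'] as the only factor that can be zero; at [x']
   the second one vanishes and leaves [x' - y]. *)
have y'E : y' = x.
  have : G x = - (h' * m%:R * (x - x') * (x - y) * (x - y')) by rewrite /G; ring.
  rewrite G0 => /esym/eqP; rewrite oppr_eq0 !mulf_eq0 -hh' (negPf h0) (negPf mK).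
  by rewrite (negPf xy0) (negPf xx0) /= subr_eq0 => /eqP.
have x'E : x' = y.
  have : G x' = - (h * m%:R * (x - x') * (x' - y) * (x' - y')) by rewrite /G; ring.
  rewrite G0 => /esym/eqP; rewrite oppr_eq0 !mulf_eq0 (negPf h0) (negPf mK).
  rewrite (negPf xx0) /= y'E -(opprB x) oppr_eq0 (negPf xx0) orbF.
  by rewrite subr_eq0 => /eqP.
(* With the conjugates swapped, [G t] is [h * (n - m) * (x - y) * (t - x) * (t - y)]; any [t] off
   the roots serves, here the reflection of [y] in [x]. *)
have : G (x + x - y) = 2%:R * h * (n%:R - m%:R) * (x - y) ^+ 3.
  by rewrite /G x'E y'E -hh'; ring.
rewrite G0 => /esym/eqP; rewrite !mulf_eq0 pnatr_eq0 (negPf h0) (negPf xy0) /= !orbF.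
by rewrite subr_eq0 eqr_nat => /eqP.
Qed.

(** In the coordinate [t] of [a0 + t * d] the line is the real axis and its reflection is
    conjugation; natural [t] suffice for [reflection_rigidity]. *)
Lemma two_root_newton_invariant_line (R : realType) (m n : nat) (h a b : R[i])
    (F : sphere R -> sphere R) (a0 d : R[i]) :
  two_root_newton m n h a b F -> (0 < m)%N -> (0 < n)%N -> a != b -> h != 0 ->
  d != 0 ->
  (forall t : R, a != a0 + t%:C%C * d) ->
  (forall t : R, F (Some (a0 + t%:C%C * d)) = None \/
    exists u : R, F (Some (a0 + t%:C%C * d)) = Some (a0 + u%:C%C * d)) ->
  m = n /\ h \is Num.real.
Proof.
move=> [F0 F1 F2] m0 n0 ab h0 d0 aL FL.
have [x aE] : exists x, a = a0 + x * d.
  by exists ((a - a0) / d); rewrite divfK // addrC subrK.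
have [y bE] : exists y, b = a0 + y * d.
  by exists ((b - a0) / d); rewrite divfK // addrC subrK.
have xy : x != y by apply: contraNneq ab => xy; rewrite aE bE xy.
have xx' : x != x^*%C.
  apply/eqP => xx'; have := aL (complex.Re x); rewrite {1}aE => /eqP; apply.
  congr (_ + _ * _); case: (x) xx' => u v [] /eqP.
  by rewrite -addr_eq0 -mulr2n mulrn_eq0 => /eqP ->.
have [] := @reflection_rigidity _ m n h h^*%C x x^*%C y y^*%C m0 n0 h0 xy xx'.
  move=> j; set t : R[i] := j%:R.
  have tJ : t^*%C = t by rewrite conjc_nat.
  pose D := m%:R * (t - y) + n%:R * (t - x).
  have DJ : D^*%C = m%:R * (t - y^*%C) + n%:R * (t - x^*%C).
    by rewrite /D rmorphD !rmorphM !rmorphB /= !conjc_nat.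
  rewrite -DJ -/D.
  have tC : t = (j%:R : R)%:C%C by rewrite rmorph_nat.
  have zE : m%:R * (a0 + t * d - b) + n%:R * (a0 + t * d - a) = d * D.
    by rewrite aE bE /D; ring.
  (* At a pole both denominators vanish, so the identity is trivial there. *)
  have [D0|D0] := eqVneq D 0; first by rewrite D0 conjc0 !mulr0.
  have [|[u]] := FL j%:R; rewrite -tC F2 ?zE ?mulf_neq0 // => -[].
  rewrite aE bE => hu.
  (* Since [t] and [u] are real, conjugation gives the same equation for the conjugate data;
     cross-multiplying eliminates [u]. *)
  have hE : h * (t - x) * (t - y) = (t - u%:C%C) * D.
    apply: (mulfI d0).
    have -> : d * ((t - u%:C%C) * D) = (a0 + t * d - (a0 + u%:C%C * d)) * D by ring.
    by rewrite -hu; field; rewrite D0 d0.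
  have conjB (v w : R[i]) : (v - w)^*%C = v^*%C - w^*%C by exact: rmorphB.
  have conjM (v w : R[i]) : (v * w)^*%C = v^*%C * w^*%C by exact: rmorphM.
  have := congr1 (@conjc R) hE; rewrite !conjM !conjB tJ conjc_real => hE'.
  by rewrite hE hE'; ring.
move=> hh mn; split=> //; case: (h) hh => u v [] /eqP.
by rewrite -addr_eq0 -mulr2n mulrn_eq0 complex_real.
Qed.

(** * Equal multiplicities and the Blaschke product *)

(** The identity [idQ] makes the deficit of squared moduli [1 - c ^+ 2] times
    [cabs u ^+ 2 - cabs v ^+ 2]. The estimate [cabs (u + c * v) <= 2 * cabs u] makes it a proportion
    of the right side, hence the 4. *)
Lemma blaschke_contraction (R : realType) (c r : R) (u v : R[i]) :
  -1 < c < 1 -> 0 <= r < 1 -> cabs v <= r * cabs u ->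
  cabs (c%:C%C * u + v) <=
    Num.sqrt (1 - (1 - c ^+ 2) * (1 - r ^+ 2) / 4) * cabs (u + c%:C%C * v).
Proof.
move=> /andP[c0 c1] /andP[r0 r1] vu; have u0 := cabs_ge0 u; have v0 := cabs_ge0 v.
have c2 : 0 < 1 - c ^+ 2 <= 1 by apply/andP; split; nra.
have r2 : 0 < 1 - r ^+ 2 <= 1 by apply/andP; split; nra.
set E := (1 - c ^+ 2) * (1 - r ^+ 2).
have E1 : 0 <= E <= 1 by rewrite /E; apply/andP; split; nra.
have k0 : 0 <= 1 - E / 4 by lra.
rewrite -(@ler_pXn2r _ 2) // ?nnegrE ?mulr_ge0 ?cabs_ge0 ?sqrtr_ge0 //.
rewrite exprMn (sqr_sqrtr k0).
have idQ : cabs (c%:C%C * u + v) ^+ 2 = cabs (u + c%:C%C * v) ^+ 2 -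
    (1 - c ^+ 2) * (cabs u ^+ 2 - cabs v ^+ 2).
  by rewrite !sqr_cabs; case: (u) => u1 u2; case: (v) => v1 v2 /=; ring.
have Q4 : cabs (u + c%:C%C * v) <= 2 * cabs u.
  apply: (le_trans (cabs_triangle _ _)); rewrite cabsM cabs_real.
  have : `|c| <= 1 by rewrite ler_norml; lra.
  have := normr_ge0 c; nra.
have Q0 := cabs_ge0 (u + c%:C%C * v).
rewrite idQ; move: (cabs (u + _)) Q4 Q0 => Q Q4 Q0.
have v2 : cabs v ^+ 2 <= r ^+ 2 * cabs u ^+ 2.
  by rewrite -exprMn ler_pXn2r // ?nnegrE // mulr_ge0.
have Q2 : Q ^+ 2 <= 4 * cabs u ^+ 2 by nra.
have h1 : E * cabs u ^+ 2 <= (1 - c ^+ 2) * (cabs u ^+ 2 - cabs v ^+ 2).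
  by rewrite /E -mulrA ler_wpM2l //; lra.
have h2 : E * Q ^+ 2 <= E * (4 * cabs u ^+ 2) by rewrite ler_wpM2l //; lra.
lra.
Qed.

(* For [m = n] and real [h], in the coordinate [(z - a) / (z - b)] the map is the Blaschke
   product [w (w + c) / (1 + c w)] with [c = 1 - h / m] in ]-1, 1[. *)
Lemma two_root_newton_blaschke (R : realType) (m : nat) (e : R) (a b : R[i])
    (F : sphere R -> sphere R) (r : R) :
  two_root_newton m m e%:C%C a b F -> (0 < m)%N -> a != b ->
  0 < e < 2 * m%:R -> 0 <= r < 1 ->
  exists k : R, 0 <= k < 1 /\
    forall (s : R) (z : R[i]), 0 <= s <= r -> cabs (z - a) <= s * cabs (z - b) ->
      exists w, F (Some z) = Some w /\ cabs (w - a) <= k * s * cabs (w - b).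
Proof.
move=> FN m0 ab /andP[e0 e1] r01.
have M0 : 0 < m%:R :> R by rewrite ltr0n.
pose c : R := (m%:R - e) / m%:R.
have cM : c * m%:R = m%:R - e by rewrite divfK // gt_eqF.
have c1 : -1 < c < 1 by rewrite ltr_pdivlMr // ltr_pdivrMr //; lra.
have r2 : 0 < 1 - r ^+ 2 <= 1 by case/andP: r01 => *; apply/andP; split; nra.
have c2 : 0 < 1 - c ^+ 2 <= 1 by case/andP: c1 => *; apply/andP; split; nra.
set E := (1 - c ^+ 2) * (1 - r ^+ 2).
have E1 : 0 < E <= 1 by rewrite /E; apply/andP; split; nra.
exists (Num.sqrt (1 - E / 4)); split.
  rewrite sqrtr_ge0 /= -[ltRHS]sqrtr1 ltr_sqrt; lra.
apply: (two_root_newton_contraction FN (sqrtr_ge0 _)) => z hz.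
have zb : 0 < cabs (z - b).
  rewrite cabs_gt0 subr_eq0; apply: contraNneq ab => zb; move: hz.
  rewrite zb subrr cabs0 mulr0 => h0.
  by rewrite -subr_eq0 -cabs_eq0 eq_le cabs_ge0 cabsB h0.
have MC : (m%:R : R[i]) != 0 by rewrite pnatr_eq0 -lt0n.
split.
  rewrite -mulrDr mulf_neq0 // -cabs_gt0.
  by apply: lt_le_trans (cabs_sub_ge _ _); case/andP: r01 => *; nra.
have meE : m%:R - e%:C%C = m%:R * c%:C%C.
  by rewrite -!(rmorph_nat (real_complex R)) -rmorphB -rmorphM /= mulrC cM.
rewrite meE -!(mulrA m%:R) -!mulrDr !cabsM mulrCA ler_wpM2l ?cabs_ge0 //.
exact: blaschke_contraction.
Qed.

(** * Common boundary of two basins *)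

Lemma chordal_cvg_unique (R : realType) (f : nat -> sphere R) (a : R[i])
    (l : sphere R) :
  (forall e : R, 0 < e -> exists N : nat, forall n, (N <= n)%N ->
    exists w, f n = Some w /\ cabs (w - a) < e) ->
  (forall e : R, 0 < e -> exists N : nat, forall n, (N <= n)%N -> chordal (f n) l < e) ->
  l = Some a.
Proof.
move=> fa fl; case: l fl => [l|] fl; last first.
  exfalso; have [r [r0 hr]] := @chordal_infty R (cabs a + 1).
  have [N hN] := fl r r0; have [M hM] := fa 1 ltr01.
  have [w [fw wa]] := hM _ (leq_maxr N M); have := hN _ (leq_maxl N M).
  rewrite fw chordal_sym => /hr hw.
  by have := cabs_triangle (w - a) a; rewrite subrK; lra.
have [->//|la] := eqVneq l a; exfalso.
have g0 : 0 < cabs (l - a) / 2 by rewrite divr_gt0 // cabs_gt0 subr_eq0.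
have [r [r0 hr]] := chordal_finite l g0.
have [N hN] := fl r r0; have [M hM] := fa _ g0.
have [w [fw wa]] := hM _ (leq_maxr N M); have := hN _ (leq_maxl N M).
rewrite fw chordal_sym => /hr[w' [[<-] hw]].
by have := cabs_triangleB l w a; rewrite (cabsB l w); lra.
Qed.

(* Near a common boundary point of the two basins a locally uniform limit of iterates would be
   continuous, yet equal to [a] on one side and to [b] on the other. *)
Lemma julia_basin_boundary (R : realType) (F : sphere R -> sphere R) (a b : R[i])
    (A B : R[i] -> Prop) (x : sphere R) :
  chordal_continuous F -> a != b ->
  (forall z, A z -> forall e : R, 0 < e -> exists N : nat, forall n, (N <= n)%N ->
    exists w, iter n F (Some z) = Some w /\ cabs (w - a) < e) ->
  (forall z, B z -> forall e : R, 0 < e -> exists N : nat, forall n, (N <= n)%N ->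
    exists w, iter n F (Some z) = Some w /\ cabs (w - b) < e) ->
  (forall r : R, 0 < r -> exists z, A z /\ chordal x (Some z) < r) ->
  (forall r : R, 0 < r -> exists z, B z /\ chordal x (Some z) < r) ->
  julia F x.
Proof.
move=> cF ab hA hB xA xB [U [oU [Ux nU]]].
have [s [g [hs hg]]] := nU id.
have [r [r0 [hrU hr]]] := hg x Ux.
have gE (P : R[i] -> Prop) (p : R[i]) :
    (forall z, P z -> forall e : R, 0 < e -> exists N : nat, forall n, (N <= n)%N ->
      exists w, iter n F (Some z) = Some w /\ cabs (w - p) < e) ->
    forall z, P z -> chordal x (Some z) < r -> g (Some z) = Some p.
  move=> hP z Pz xz.
  apply: (@chordal_cvg_unique _ (fun n => iter (s n) F (Some z))) => e e0.
    have [N hN] := hP z Pz e e0; exists N => n Nn; apply: hN.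
    exact: leq_trans Nn (increasing_ge_id hs n).
  by have [N hN] := hr e e0; exists N => n Nn; apply: hN.
have gA := gE _ _ hA; have gB := gE _ _ hB.
(* One iterate [f] close to the limit replaces the limit itself, being continuous. The chain from
   [a] to [b] through [f x] has four links, hence the quarter. *)
have d0 : 0 < cabs (a - b) / 4 by rewrite divr_gt0 // cabs_gt0 subr_eq0.
set d := cabs (a - b) / 4 in d0.
have [ea [ea0 hea]] := chordal_finite a d0.
have [eb [eb0 heb]] := chordal_finite b d0.
have [|N hN] := hr (Num.min ea eb); first by rewrite lt_min ea0.
have {}hN := hN N (leqnn N); set f := iter (s N) F in hN.
have cf : chordal_continuous f by apply: chordal_continuous_iter.
have fA z : A z -> chordal x (Some z) < r -> exists w, f (Some z) = Some w /\ cabs (w - a) < d.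
  move=> Az xz; have := hN _ xz; rewrite gA // lt_min chordal_sym => /andP[+ _].
  exact: hea.
have fB z : B z -> chordal x (Some z) < r -> exists w, f (Some z) = Some w /\ cabs (w - b) < d.
  move=> Bz xz; have := hN _ xz; rewrite gB // lt_min chordal_sym => /andP[_].
  exact: heb.
case fx : (f x) => [y|]; last first.
  have [q [q0 hq]] := @chordal_infty R (cabs a + d).
  have [t [t0 ht]] := cf x q q0.
  have [|z [Az]] := xA (Num.min r t); first by rewrite lt_min r0.
  rewrite lt_min => /andP[xr xt].
  have [w [fw wa]] := fA z Az xr; have := ht _ xt; rewrite fx fw => /hq.
  by have := cabs_triangle (w - a) a; rewrite subrK; lra.
have [q [q0 hq]] := chordal_finite y d0.
have [t [t0 ht]] := cf x q q0.
have [|z [Az]] := xA (Num.min r t); first by rewrite lt_min r0.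
rewrite lt_min => /andP[xr xt].
have [w [fw wa]] := fA z Az xr; have := ht _ xt; rewrite fx fw => /hq[_ [[<-] wy]].
have [|z' [Bz]] := xB (Num.min r t); first by rewrite lt_min r0.
rewrite lt_min => /andP[xr' xt'].
have [w' [fw' wb]] := fB z' Bz xr'; have := ht _ xt'; rewrite fx fw' => /hq[_ [[<-] wy']].
have := cabs_triangleB a w b; have := cabs_triangleB w y b.
have := cabs_triangleB y w' b; rewrite (cabsB a w) (cabsB y w') /d in d0 wa wb wy wy' *.
lra.
Qed.

(** * The perpendicular bisector as Julia set *)

(** In the coordinate [t] the roots [a] and [b] sit at 1/2 and -1/2, so the bisector is the
    imaginary axis. *)
Lemma bisector_side (R : realType) (a b t : R[i]) : a != b ->
  let z := (a + b) / 2%:R + t * (a - b) in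
  (cabs (z - a) < cabs (z - b)) = (0 < complex.Re t).
Proof.
move=> ab z; have ab0 : 0 < cabs (a - b) by rewrite cabs_gt0 subr_eq0.
have -> : z - a = (t - (2^-1 : R)%:C%C) * (a - b) by rewrite fmorphV rmorph_nat /z; field.
have -> : z - b = (t + (2^-1 : R)%:C%C) * (a - b) by rewrite fmorphV rmorph_nat /z; field.
rewrite !cabsM ltr_pM2r // -(@ltr_pXn2r _ 2) ?nnegrE ?cabs_ge0 // !sqr_cabs.
case: t {z} => u v /=; rewrite oppr0 addr0.
by apply/idP/idP => h; nra.
Qed.

Lemma bisector_side_opp (R : realType) (a b t : R[i]) : a != b ->
  let z := (a + b) / 2%:R + t * (a - b) in
  (cabs (z - b) < cabs (z - a)) = (complex.Re t < 0).
Proof.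
move=> ab /=; have := @bisector_side R b a (- t); rewrite eq_sym => /(_ ab) /=.
rewrite mulNr -mulrN opprB [b + a]addrC => ->.
by case: t => u v /=; rewrite oppr_gt0.
Qed.

Lemma two_root_newton_basin (R : realType) (m : nat) (e : R) (a b : R[i])
    (F : sphere R -> sphere R) (z : R[i]) :
  two_root_newton m m e%:C%C a b F -> (0 < m)%N -> a != b -> 0 < e < 2 * m%:R ->
  cabs (z - a) < cabs (z - b) ->
  fatou F (Some z) /\
  forall d : R, 0 < d -> exists N : nat, forall n, (N <= n)%N ->
    exists w, iter n F (Some z) = Some w /\ cabs (w - a) < d.
Proof.
move=> FN m0 ab he hz.
have za := cabs_ge0 (z - a); have zb : 0 < cabs (z - b) by lra.
(* Contraction is uniform only for ratios up to some [r < 1]; the midpoint of [q] and 1 leaves [z]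
   strictly inside. *)
pose q := cabs (z - a) / cabs (z - b); pose r := (q + 1) / 2.
have q0 : 0 <= q by rewrite divr_ge0 // ltW.
have q1 : q < 1 by rewrite ltr_pdivrMr // mul1r.
have qE : q * cabs (z - b) = cabs (z - a) by rewrite divfK // gt_eqF.
have r01 : 0 <= r < 1 by rewrite /r; lra.
have zr : cabs (z - a) < r * cabs (z - b) by rewrite -qE ltr_pM2r // /r; lra.
have [k [k01 hk]] := two_root_newton_blaschke FN m0 ab he r01.
split; first exact: (ratio_contraction_fatou r01 k01 hk).
move=> d d0; have [N hN] := ratio_contraction_iter r01 k01 hk d0.
by exists N => n Nn; apply: hN => //; apply: ltW.
Qed.

(** The sign [s] selects the side. Infinity is approached far out in the direction [v], a finite
    point by a small step along [v]. *)
Lemma chordal_near_half_plane (R : realType) (c v : R[i]) (s : R) (x : sphere R) :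
  v != 0 -> `|s| = 1 -> (x = None \/ exists t : R, x = Some (c + (Complex 0 t) * v)) ->
  forall r : R, 0 < r -> exists t : R[i],
    0 < s * complex.Re t /\ chordal x (Some (c + t * v)) < r.
Proof.
move=> v0 s1 hx r r0.
have v1 : 0 < cabs v by rewrite cabs_gt0.
have ss : s * s = 1 by rewrite -expr2 -real_normK ?num_real // s1 expr1n.
case: hx => [->|[t ->]].
  have [M [M0 hM]] := chordal_infty_lt r0.
  have c0 := cabs_ge0 c.
  pose q := (M + cabs c + 1) / cabs v.
  have q0 : 0 < q by rewrite divr_gt0 //; lra.
  exists (s * q)%:C%C; split; first by rewrite /= mulrA ss mul1r.
  apply: hM; rewrite addrC; apply: lt_le_trans (cabs_sub_ge _ _).
  rewrite cabsM cabs_real normrM s1 mul1r gtr0_norm // divfK ?gt_eqF //; lra.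
pose q := r / (4 * cabs v).
have q0 : 0 < q by rewrite divr_gt0 // mulr_gt0.
exists (Complex (s * q) t); split; first by rewrite /= mulrA ss mul1r.
apply: (le_lt_trans (chordal_le _ _)).
have -> : c + Complex 0 t * v - (c + Complex (s * q) t * v) =
    (- (s * q))%:C%C * v.
  have -> : Complex (s * q) t = (s * q)%:C%C + Complex 0 t.
    by apply/eqP; rewrite eq_complex /= addr0 add0r !eqxx.
  by rewrite rmorphN /=; ring.
rewrite cabsM cabs_real normrN normrM s1 mul1r gtr0_norm //.
have -> : q * cabs v = r / 4 by rewrite /q; field; rewrite gt_eqF.
lra.
Qed.

Lemma julia_equal_multiplicity (R : realType) (m : nat) (e : R) (a b : R[i])
    (F : sphere R -> sphere R) :
  two_root_newton m m e%:C%C a b F -> (0 < m)%N -> a != b -> 0 < e < 2 * m%:R ->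
  chordal_continuous F -> is_line_with_infty (julia F).
Proof.
move=> FN m0 ab he cF.
have ba : b != a by rewrite eq_sym.
have ab0 : a - b != 0 by rewrite subr_eq0.
have FN' := two_root_newton_sym FN.
(* The perpendicular bisector: through the midpoint, in the direction [a - b] turned by a right
   angle. *)
exists ((a + b) / 2%:R), (Complex 0 1 * (a - b)); split.
  by rewrite mulf_neq0 // eq_complex /= oner_eq0 andbF.
have iE (t : R) : Complex t 0 * (Complex 0 1 * (a - b)) = Complex 0 t * (a - b).
  rewrite mulrA; congr (_ * _); apply/eqP; rewrite eq_complex /=.
  by rewrite !mulr0 !mul0r !mulr1 subr0 addr0 !eqxx.
move=> x; split=> [Jx|hx].
  case: x Jx => [z|] Jx; [right | by left].
  pose t := (z - (a + b) / 2%:R) / (a - b).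
  have zE : z = (a + b) / 2%:R + t * (a - b) by rewrite /t divfK // addrC subrK.
  have sA := bisector_side t ab; have sB := bisector_side_opp t ab.
  rewrite /= -zE in sA sB.
  have t0 : complex.Re t = 0.
    case: (ltrgtP (complex.Re t) 0) => // ht; exfalso; apply: Jx.
      by have [] := two_root_newton_basin FN' m0 ba he (z := z); rewrite ?sB.
    by have [] := two_root_newton_basin FN m0 ab he (z := z); rewrite ?sA.
  exists (complex.Im t); rewrite iE {1}zE; congr (Some (_ + _ * _)).
  by case: (t) t0 => u v /= ->.
have {}hx : x = None \/ exists t : R, x = Some ((a + b) / 2%:R + Complex 0 t * (a - b)).
  by case: hx => [->|[t ->]]; [left | right; exists t; rewrite iE].
apply: (@julia_basin_boundary _ F a b (fun z => cabs (z - a) < cabs (z - b))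
  (fun z => cabs (z - b) < cabs (z - a))) => //.
- by move=> z hz; have [] := two_root_newton_basin FN m0 ab he hz.
- by move=> z hz; have [] := two_root_newton_basin FN' m0 ba he hz.
- move=> r r0; have [t [t0 ht]] := chordal_near_half_plane ab0 (normr1 _) hx r0.
  by eexists; split; last exact: ht; rewrite bisector_side //; rewrite mul1r in t0.
- move=> r r0; have [t [t0 ht]] := chordal_near_half_plane ab0 (normrN1 _) hx r0.
  by eexists; split; last exact: ht; rewrite bisector_side_opp //; rewrite mulN1r oppr_gt0 in t0.
Qed.

(** * The equivalence *)

Unset Implicit Arguments.

Theorem theoremC (R : realType) (p : {poly R[i]}) (a b : R[i]) (h : R[i]) :
  p != 0 -> a != b ->
  (forall z : R[i], root p z <-> (z = a \/ z = b)) ->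
  `|h - (minn (mup a p) (mup b p))%:R| < (minn (mup a p) (mup b p))%:R ->
  (is_line_with_infty (julia (relaxed_newton h p)) <->
   (mup a p = mup b p /\ h \is Num.real)).
Proof.
move=> p0 ab rp.
have m0 : (0 < mup a p)%N.
  by rewrite -XsubC_dvd // dvdp_XsubCl; apply/rp; left.
have n0 : (0 < mup b p)%N.
  by rewrite -XsubC_dvd // dvdp_XsubCl; apply/rp; right.
have c0 : lead_coef p != 0 by rewrite lead_coef_eq0.
have := relaxed_newton_two_roots h c0 ab m0 n0.
rewrite -(two_roots_factor p0 ab rp).
move: (relaxed_newton h p) (mup a p) (mup b p) m0 n0 => F m n m0 n0 FN.
rewrite normc_cabs -(rmorph_nat (real_complex R)) ltcR rmorph_nat => hmu.
(* The discs centred at [k] of radius [k] all touch at 0 and grow with [k], so the condition for the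
   smaller multiplicity covers both roots. *)
have hball (k : nat) : (minn m n <= k)%N -> cabs (h - k%:R) < k%:R.
  move=> hk; have := cabs_triangleB h (minn m n)%:R k%:R.
  rewrite (cabsB (minn m n)%:R) -natrB // cabs_natr natrB //; lra.
have hm := hball m (geq_minl m n); have hn := hball n (geq_minr m n).
have h0 : h != 0 by apply: contraTneq hm => ->; rewrite sub0r cabsN cabs_natr ltxx.
have hs : h != (m + n)%:R.
  by apply: contraTneq hmu => ->; rewrite -natrB ?cabs_natr -?leNgt ?ler_nat; lia.
have cF : chordal_continuous F by exact: two_root_newton_continuous FN m0 n0 ab h0 hs.
split=> [[a0 [d [d0 hJ]]]|[mn hreal]].
  (* The root [a] is a Fatou point, hence off the line; forward invariance of the Julia set keeps
     images on the line or at infinity. *)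
  apply: (two_root_newton_invariant_line FN m0 n0 ab h0 d0 (a0 := a0)).
    move=> t; apply/eqP => aE.
    have /hJ : Some a = None \/ exists t : R, Some a = Some (a0 + Complex t 0 * d).
      by right; exists t; rewrite {1}aE.
    by apply; apply: two_root_newton_fatou_root FN ab hm hn.
  move=> t; have /hJ : julia F (F (Some (a0 + t%:C%C * d))).
    move=> /(fatou_preimage cF) fx.
    have /hJ : Some (a0 + t%:C%C * d) = None \/
        exists u : R, Some (a0 + t%:C%C * d) = Some (a0 + Complex u 0 * d).
      by right; exists t.
    by apply.
  by [].
have [e hE] : exists e, h = e%:C%C by apply/complex_realP.
move: FN hm; rewrite hE -mn => FN.
rewrite -(rmorph_nat (real_complex R)) -rmorphB cabs_real ltr_norml => /andP[h1 h2].
apply: (julia_equal_multiplicity FN) => //; lra.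
Qed.
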